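(* Consider a structured problem in the class $\mathcal{SP}(m_f,\sigma_f,\bar\sigma_f,L,\delta)$ and let $\{(z_{k-1},w_{k-1},x_k,\hat x_k)\}_{k\ge0}$ be generated by Method S (either the classical or the modified variant) with weight parameters $\{\lambda_k\}_{k\ge0}$ and scaling parameters $\{\beta_k\}_{k\ge-1}$. Then for every $k\ge0$ $$f(\hat x_k)-f(x^* )+\sigma_f\xi(z_k,x^* )\le\frac{\beta_kl_d(z_k;x^* )+C_k}{S_k},$$ where, for the classical method, $$C_k:=\frac12\sum_{i=0}^k\lambda_i\left(L(x_i)-\sigma_d\left(\bar\sigma_f+\frac{\beta_{i-1}+S_{i-1}\sigma_f}{\lambda_i}\right)\right)\|w_i-x_i\|^2+\sum_{i=0}^k\lambda_i\delta(x_i,w_i),$$ and, for the modified method, $$C_k:=\frac12\sum_{i=0}^kS_i\left(L(x_i)-\sigma_d\left(\bar\sigma_f+\frac{S_i(\beta_{i-1}+S_{i-1}\sigma_f)}{\lambda_i^2}\right)\right)\|\hat x_i-x_i\|^2+\sum_{i=0}^kS_i\delta(x_i,\hat x_i).$$ Furthermore, for the classical method (with $C_k$ as defined for the classical method) and every $k\ge0$, $$\frac1{S_k}\sum_{i=0}^k\lambda_if(w_i)-f(x^* )+\sigma_f\xi(z_k,x^* )\le\frac{\beta_kl_d(z_k;x^* )+C_k}{S_k}$$ and $$\min_{0\le i\le k}f(w_i)-f(x^* )+\sigma_f\xi(z_k,x^* )\le\frac{\beta_kl_d(z_k;x^* )+C_k}{S_k}.$$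
   Context: Setting. $E$ is a finite-dimensional real normed space with norm $\|\cdot\|$; $E^*$ is its dual, with pairing $\langle s,x\rangle$. $Q\subset E$ is a closed convex set and $f:E\to\mathbb R\cup\{+\infty\}$ is a lower-semicontinuous (lsc) convex function with $Q\subset \mathrm{dom} f$. The problem $\min_{x\in Q}f(x)$ is assumed to have an optimal solution; $x^*\in Q$ denotes one. A prox-function $d:E\to\mathbb R\cup\{+\infty\}$ is fixed: $d$ is nonnegative, continuously differentiable and strongly convex on $Q$ ($Q\subset\mathrm{dom}\,d$) with constant $\sigma_d>0$ with respect to $\|\cdot\|$, and $d(x_0)=\min_{x\in Q}d(x)=0$ for its unique minimizer $x_0\in Q$. For $x,y\in Q$: $l_d(y;x):=d(y)+\langle\nabla d(y),x-y\rangle$ and $\xi(y,x):=d(x)-l_d(y;x)$ (Bregman distance). For an lsc convex $\psi:E\to\mathbb R\cup\{+\infty\}$ with $Q\subset\mathrm{dom}\,\psi$, $\sigma(\psi):=\{\tau\ge0:\psi(x)-\tau d(x)\text{ is an lsc convex function on }Q\}$. Class $\mathcal{SP}(m_f,\sigma_f,\bar\sigma_f,L,\delta)$: problems $\min_{x\in Q}f(x)$ for which the following are given. For each $y\in Q$, $m_f(y;\cdot):E\to\mathbb R\cup\{+\infty\}$ is an lsc convex function (with $Q$ in its domain) with $m_f(y;x)\le f(x)$ for all $x\in Q$; $\sigma_f\ge0$ satisfies $\sigma_f\in\sigma(f)\cap\bigcap_{y\in Q}\sigma(m_f(y;\cdot))$; $\bar\sigma_f\in[0,\sigma_f]$; $L(\cdot)\ge0$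 is a function on $Q$; $\delta(y,\cdot)$ is a nonnegative convex function on $Q$ for each $y\in Q$; and $$f(x)\le[m_f(y;x)-\bar\sigma_f\xi(y,x)]+\tfrac{L(y)}2\|y-x\|^2+\delta(y,x)\quad\forall x,y\in Q.$$ Subproblems $\min_{x\in Q}\{m_f(y;x)+\langle s,x\rangle+\beta d(x)\}$ ($\beta\ge0$, $s\in E^*$) are assumed solvable ($Q$ is additionally assumed bounded when $\beta=0$ and $\sigma_f=0$). Parameters. Weight parameters $\lambda_k>0$ ($k\ge0$); scaling parameters $\beta_k\ge0$ ($k\ge-1$), nondecreasing in $k$. $S_k:=\sum_{i=0}^k\lambda_i$, $S_{-1}:=0$. Property 2 for a coupled sequence of functions $\{(\varphi_k(x),\psi_k(x))\}_{k\ge-1}$ (associated with $\{\lambda_k\},\{\beta_k\}$ and test points $\{x_k\}_{k\ge0}$), with $z_k:=\mathrm{argmin}_{x\in Q}\varphi_k(x)$, $w_k:=\mathrm{argmin}_{x\in Q}\psi_k(x)$ (minimizers assumed to exist): (B0) $\varphi_k(x)\ge\psi_k(x)$ for all $x\in Q$, $k\ge -1$. (B1) $\psi_{-1}(w_{-1})=0$ and $z_{-1}=w_{-1}=x_0$. (B2) For all $k\ge-1$, $x\in Q$: $\psi_{k+1}(x)\ge\varphi_k(z_k)+\lambda_{k+1}m_f(x_{k+1};x)+\beta_{k+1}d(x)-\beta_kl_d(z_k;x)+S_k\sigma_f\xi(z_k,x)$. (B3) For all $k\ge-1$: $\psi_k(w_k)\le\min_{x\in Q}\{\sum_{i=0}^k\lambda_im_f(x_i;x)+\beta_kl_d(z_k;x)-S_k\sigma_f\xi(z_k,x)\}$.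 Method S. With a coupled sequence $\{(\varphi_k,\psi_k)\}_{k\ge-1}$ satisfying Property 2: set $x_0:=z_{-1}:=w_{-1}:=\mathrm{argmin}_{x\in Q}d(x)$, $z_0:=\mathrm{argmin}_{x\in Q}\varphi_0(x)$, $\hat x_0:=w_0:=\mathrm{argmin}_{x\in Q}\psi_0(x)$. For $k\ge0$ set $x_{k+1}:=z_k$ (classical method) or $x_{k+1}:=\frac{S_k\hat x_k+\lambda_{k+1}z_k}{S_{k+1}}$ (modified method); then $z_{k+1}:=\mathrm{argmin}_{x\in Q}\varphi_{k+1}(x)$, $w_{k+1}:=\mathrm{argmin}_{x\in Q}\psi_{k+1}(x)$, $\hat x_{k+1}:=\frac{S_k\hat x_k+\lambda_{k+1}w_{k+1}}{S_{k+1}}$. *)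

(* Defs.v *)
Set Warnings "-notation-overridden,-ambiguous-paths,-notation-incompatible-prefix".
From HB Require Import structures.
From mathcomp Require Import all_boot all_order all_algebra.
From mathcomp Require Import classical_sets boolp reals ereal.
From mathcomp Require Import interval_inference topology normedtype landau.
From mathcomp Require Import sequences convex.

Set Implicit Arguments.
Unset Strict Implicit.
Unset Printing Implicit Defensive.

Import Order.TTheory GRing.Theory Num.Theory.
Import numFieldNormedType.Exports.

Local Open Scope classical_set_scope.
Local Open Scope ring_scope.
Local Open Scope ereal_scope.

(* Finite-dimensional normed spaces: the norm is arbitrary, and the vectType
   structure provides a linear bijection with some 'rV[R]_n. *)
#[short(type="normedVectType")]
HB.structure Definition NormedVector (R : numFieldType) :=
  {E of NormedModule R E & Vector R E}.


Section ConvexFunctions.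
Context {R : realType} {E : normedVectType R}.
Implicit Types (Q : set E) (g : E -> \bar R).

Definition dom g : set E := [set x | g x < +oo].

(* Only used where g does not take the value -oo; the convention 0 * +oo = 0
   makes the cases t = 0 and t = 1 harmless. *)
Definition convex_on Q g := forall (x y : E) (t : R),
  Q x -> Q y -> (0 <= t <= 1)%R ->
  g (t *: x + (1 - t) *: y)%R <= t%:E * g x + (1 - t)%:E * g y.

(* Lower semicontinuity relative to Q: in the topology of [subspace Q], the
   neighborhoods of a point of Q are its neighborhoods within Q, and the points
   outside Q are isolated. *)
Definition lsc_on Q g := lower_semicontinuous (g : subspace Q -> \bar R).

Record lsc_convex_on Q g : Prop := LscConvexOn {
  lsc_convex_on_gtNy : forall x, Q x -> -oo < g x;
  lsc_convex_on_convex : convex_on Q g;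
  lsc_convex_on_lsc : lsc_on Q g }.

(* lsc convex functions from E to R u {+oo} *)
Record lsc_convex g : Prop := LscConvex {
  lsc_convex_gtNy : forall x, -oo < g x;
  lsc_convex_convex : convex_on setT g;
  lsc_convex_lsc : lower_semicontinuous g }.

Definition strongly_convex_on Q g (sigma : R) := forall (x y : E) (t : R),
  Q x -> Q y -> (0 <= t <= 1)%R ->
  g (t *: x + (1 - t) *: y)%R <=
    t%:E * g x + (1 - t)%:E * g y
    - (sigma / 2 * t * (1 - t) * `|x - y| ^+ 2)%:E.

Definition is_argmin Q g (a : E) := Q a /\ forall x, Q x -> g a <= g x.

(* E^* is {linear E -> R^o}: every linear form is continuous, E being
   finite-dimensional.  The gradient of g at y in Q is taken relative to Q, so
   that g may be +oo outside Q and Q may have an empty interior; when g is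
   differentiable at y in the usual sense, its differential satisfies this. *)
Definition is_gradient_on Q g (dg : E -> {linear E -> R^o}) :=
  forall y, Q y ->
    ((fun x : E => fine (g x) - fine (g y) - dg y (x - y) : R^o)
       =o_ (within Q (nbhs y)) (fun x : E => x - y))%R.

(* continuity on Q for the operator norm of E^* *)
Definition continuous_gradient_on Q (dg : E -> {linear E -> R^o}) :=
  forall y, Q y -> forall e : R, (0 < e)%R ->
    \forall v \near within Q (nbhs y),
      forall h : E, (`|dg v h - dg y h| <= e * `|h|)%R.

End ConvexFunctions.

Section ProxFunction.
Context {R : realType} {E : normedVectType R}.
Variables (Q : set E) (d : E -> \bar R) (dd : E -> {linear E -> R^o}).

(* dd is the gradient of d on Q. *)
Record prox_function (sigma_d : R) (x0 : E) : Prop := ProxFunction {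
  prox_gtNy : forall x, -oo < d x;
  prox_dom : Q `<=` dom d;
  prox_ge0 : forall x, Q x -> 0 <= d x;
  prox_gradient : is_gradient_on Q d dd;
  prox_gradient_continuous : continuous_gradient_on Q dd;
  prox_sigma_gt0 : (0 < sigma_d)%R;
  prox_strongly_convex : strongly_convex_on Q d sigma_d;
  prox_argmin : is_argmin Q d x0;
  prox_argmin_unique : forall x, is_argmin Q d x -> x = x0;
  prox_min0 : d x0 = 0 }.

(* l_d(y; x) and the Bregman distance xi(y, x), meant for x, y in Q, where d is
   finite. *)
Definition l_d (y x : E) : R := (fine (d y) + dd y (x - y))%R.
Definition xi (y x : E) : R := (fine (d x) - l_d y x)%R.

Definition convexity_moduli (psi : E -> \bar R) : set R :=
  [set tau | (0 <= tau)%R /\ lsc_convex_on Q (fun x => psi x - tau%:E * d x)].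

Record structured_problem (f : E -> \bar R) (m : E -> E -> \bar R)
    (sigma_f bsigma_f : R) (L : E -> R) (delta : E -> E -> R) : Prop :=
  StructuredProblem {
  sp_f : lsc_convex f;
  sp_f_dom : Q `<=` dom f;
  sp_m : forall y, Q y -> lsc_convex (m y);
  sp_m_dom : forall y, Q y -> Q `<=` dom (m y);
  sp_m_le : forall y x, Q y -> Q x -> m y x <= f x;
  sp_sigma :
    (convexity_moduli f `&` \bigcap_(y in Q) convexity_moduli (m y)) sigma_f;
  sp_bsigma : (0 <= bsigma_f <= sigma_f)%R;
  sp_L_ge0 : forall y, Q y -> (0 <= L y)%R;
  sp_delta_ge0 : forall y x, Q y -> Q x -> (0 <= delta y x)%R;
  sp_delta_convex : forall y, Q y -> convex_function Q (delta y);
  sp_upper : forall y x, Q y -> Q x ->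
    f x <= (m y x - (bsigma_f * xi y x)%:E)
           + (L y / 2 * `|y - x| ^+ 2)%:E + (delta y x)%:E;
  sp_solvable : forall (y : E) (s : {linear E -> R^o}) (beta : R),
    Q y -> (0 <= beta)%R ->
    (beta = 0%R -> sigma_f = 0%R -> bounded_set Q) ->
    exists a, is_argmin Q (fun x => m y x + (s x : R)%:E + beta%:E * d x) a }.

End ProxFunction.

(* Index shift: the sequences that start at k = -1 are nat-indexed with an
   offset of one, i.e. beta n, phi n, psi n, z n, w n stand for beta_{n-1},
   phi_{n-1}, psi_{n-1}, z_{n-1}, w_{n-1}; likewise Ssum lambda n is S_{n-1}.  The
   sequences lambda, x and xhat start at 0 and are not shifted. *)
Section Method.
Context {R : realType} {E : normedVectType R}.

Definition Ssum (lambda : nat -> R) (n : nat) : R := (\sum_(i < n) lambda i)%R.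

Record method_parameters (lambda beta : nat -> R) : Prop := MethodParameters {
  lambda_gt0 : forall k, (0 < lambda k)%R;
  beta_ge0 : forall n, (0 <= beta n)%R;
  beta_nondecreasing : nondecreasing_seq beta }.

Variables (Q : set E) (d : E -> \bar R) (dd : E -> {linear E -> R^o}).
Variables (lambda beta : nat -> R).

Local Notation S := (Ssum lambda).
Local Notation l_d := (l_d d dd).
Local Notation xi := (xi d dd).

(* The minimum in B3 is written as an infimum: its attainment is not needed to
   make sense of the inequality. *)
Record property2 (m : E -> E -> \bar R) (sigma_f : R) (x0 : E)
    (phi psi : nat -> E -> \bar R) (x z w : nat -> E) : Prop := Property2 {
  p2_z : forall n, is_argmin Q (phi n) (z n);
  p2_w : forall n, is_argmin Q (psi n) (w n);
  p2_B0 : forall n u, Q u -> psi n u <= phi n u;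
  p2_B1 : [/\ psi 0%N (w 0%N) = 0, z 0%N = x0 & w 0%N = x0];
  p2_B2 : forall n u, Q u ->
    phi n (z n) + (lambda n)%:E * m (x n) u + (beta n.+1)%:E * d u
      - (beta n * l_d (z n) u)%:E + (S n * sigma_f * xi (z n) u)%:E
    <= psi n.+1 u;
  p2_B3 : forall n,
    psi n (w n) <= ereal_inf [set (\sum_(i < n) (lambda i)%:E * m (x i) u)
                                  + (beta n * l_d (z n) u)%:E
                                  - (S n * sigma_f * xi (z n) u)%:E | u in Q] }.

Variant version := Classical | Modified.

(* The choices z_k = argmin phi_k and w_k = argmin psi_k are part of
   property2. *)
Record method_S (v : version) (m : E -> E -> \bar R) (sigma_f : R) (x0 : E)
    (phi psi : nat -> E -> \bar R) (x z w xhat : nat -> E) : Prop := MethodS {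
  ms_property2 : property2 m sigma_f x0 phi psi x z w;
  ms_x0 : x 0%N = x0;
  ms_xhat0 : xhat 0%N = w 1%N;
  ms_xS : forall k, x k.+1 =
    match v with
    | Classical => z k.+1
    | Modified =>
        ((S k.+2)^-1 *: (S k.+1 *: xhat k + lambda k.+1 *: z k.+1))%R
    end;
  ms_xhatS : forall k, xhat k.+1 =
    ((S k.+2)^-1 *: (S k.+1 *: xhat k + lambda k.+1 *: w k.+2))%R }.

Definition Cterm (v : version) (sigma_d sigma_f bsigma_f : R) (L : E -> R)
    (delta : E -> E -> R) (x w xhat : nat -> E) (k : nat) : R :=
  (match v with
  | Classical =>
      2^-1 * (\sum_(i < k.+1) lambda i *
        (L (x i) - sigma_d *
           (bsigma_f + (beta i + S i * sigma_f) / lambda i)) *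
        `|w i.+1 - x i| ^+ 2)
      + \sum_(i < k.+1) lambda i * delta (x i) (w i.+1)
  | Modified =>
      2^-1 * (\sum_(i < k.+1) S i.+1 *
        (L (x i) - sigma_d *
           (bsigma_f + S i.+1 * (beta i + S i * sigma_f) / lambda i ^+ 2)) *
        `|xhat i - x i| ^+ 2)
      + \sum_(i < k.+1) S i.+1 * delta (x i) (xhat i)
  end)%R.

End Method.

(* Main.v *)
Set Warnings "-notation-overridden,-ambiguous-paths,-notation-incompatible-prefix".
Require Import Defs.
From HB Require Import structures.
From mathcomp Require Import all_boot all_order all_algebra.
From mathcomp Require Import classical_sets boolp reals ereal.
From mathcomp Require Import interval_inference topology normedtype landau.
From mathcomp Require Import sequences convex.
From mathcomp Require Import ring lra.

Set Implicit Arguments.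
Unset Strict Implicit.
Unset Printing Implicit Defensive.

Import Order.TTheory GRing.Theory Num.Theory.
Import numFieldNormedType.Exports.

Local Open Scope classical_set_scope.
Local Open Scope ring_scope.
Local Open Scope ereal_scope.

(* Estimate-sequence argument.  By induction, psi_k(w_k) + C_k dominates
   sum_i lambda_i f(w_i) (classical method) or S_k f(xhat_k) (modified method);
   comparing with the upper bound B3 at u = x^* and dividing by S_k gives the
   rates.  For the induction step, B2 at u = w_{k+1}, B0 and the monotonicity of
   beta yield
     psi_{k+1}(w_{k+1}) >= psi_k(w_k) + lambda_{k+1} m(x_{k+1}; w_{k+1})
                           + (beta_k + S_k sigma_f) xi(z_k, w_{k+1}),
   where xi(y, u) >= sigma_d / 2 |u - y|^2 by strong convexity of d.  In the
   classical method x_{k+1} = z_k and the upper model of f at x_{k+1} is applied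
   at w_{k+1}.  In the modified method it is applied at xhat_{k+1}, after
   bounding m(x_{k+1}; xhat_{k+1}) by convexity; there
   xhat_{k+1} - x_{k+1} = lambda_{k+1} / S_{k+1} (w_{k+1} - z_k). *)

(** * Normalized weighted means in a convex set *)

Section WeightedMean.
Context {R : realType} {E : normedVectType R}.
Variables (Q : set E).
Hypothesis Q_convex : convex_set (Q : set (convex_lmodType E)).
Implicit Types (a b : R) (u v : E).

Lemma convex_set_conv u v (t : R) : Q u -> Q v -> (0 <= t <= 1)%R ->
  Q (t *: u + (1 - t) *: v)%R.
Proof.
move=> Qu Qv /andP[t0 t1].
have i01 : Itv.spec (@Itv.num_sem R) (Itv.Real `[0%Z, 1%Z]) t.
  by apply/and3P; split; rewrite ?num_real//= bnd_simp.
have := @Q_convex u v (Itv.mk i01); rewrite !inE => /(_ Qu Qv).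
exact.
Qed.

Lemma weighted_meanE a b u v : (0 <= a)%R -> (0 < b)%R ->
  exists2 t, (0 <= t <= 1)%R &
    ((a + b)^-1 *: (a *: u + b *: v) = t *: u + (1 - t) *: v)%R /\
    (a = (a + b) * t /\ b = (a + b) * (1 - t))%R.
Proof.
move=> a0 b0; have ab0 : (0 < a + b)%R by rewrite ltr_wpDl.
have abN0 : (a + b != 0)%R by rewrite gt_eqF.
exists (a / (a + b))%R.
  by rewrite divr_ge0 ?(ltW ab0)//= ler_pdivrMr// mul1r lerDl ltW.
have tb : (1 - a / (a + b) = b / (a + b))%R by field.
by rewrite tb scalerDr !scalerA ![(_^-1 * _)%R]mulrC; do !split => //; field.
Qed.

Lemma weighted_mean_in a b u v : (0 <= a)%R -> (0 < b)%R -> Q u -> Q v ->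
  Q ((a + b)^-1 *: (a *: u + b *: v))%R.
Proof.
move=> a0 b0 Qu Qv; have [t t01 [-> _]] := weighted_meanE u v a0 b0.
exact: convex_set_conv.
Qed.

Lemma convex_on_weighted_mean (g : E -> \bar R) a b u v :
  convex_on Q g -> {in Q, forall y, g y \is a fin_num} ->
  (0 <= a)%R -> (0 < b)%R -> Q u -> Q v ->
  ((a + b) * fine (g ((a + b)^-1 *: (a *: u + b *: v)))
     <= a * fine (g u) + b * fine (g v))%R.
Proof.
move=> cg fg a0 b0 Qu Qv; have ab0 : (0 < a + b)%R by rewrite ltr_wpDl.
have Qm := weighted_mean_in a0 b0 Qu Qv.
have [t t01 [mE [aE bE]]] := weighted_meanE u v a0 b0.
have := cg u v t Qu Qv t01; rewrite -mE.
rewrite -(fineK (fg _ (mem_set Qm))) -(fineK (fg u (mem_set Qu))).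
rewrite -(fineK (fg v (mem_set Qv))) -!EFinM -EFinD lee_fin.
rewrite -(ler_pM2l ab0) => /le_trans; apply.
by rewrite mulrDr !mulrA -aE -bE.
Qed.

End WeightedMean.

(** Strong convexity on the segment from [u] to [v] is compared with the first-order expansion of
    [d] at [u]; dividing by the step [t] and letting [t] tend to 0 gives the bound. The limit is
    replaced by one small [t] for each tolerance [e]. *)
Lemma xi_lower_bound (R : realType) (E : normedVectType R) (Q : set E)
    (d : E -> \bar R) (dd : E -> {linear E -> R^o}) (sigma_d : R) (u v : E) :
  convex_set (Q : set (convex_lmodType E)) ->
  {in Q, forall y, d y \is a fin_num} ->
  is_gradient_on Q d dd -> strongly_convex_on Q d sigma_d -> Q u -> Q v ->
  (sigma_d / 2 * `|v - u| ^+ 2 <= xi d dd u v)%R.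
Proof.
move=> cQ fd gd sd Qu Qv; rewrite /xi /l_d.
set r := `|v - u|%R; set s := (sigma_d / 2 * r ^+ 2)%R.
have r0 : (0 <= r)%R by exact: normr_ge0.
apply/ler_addgt0Pr => e e0.
(* The gradient error [e' * (t * r)] must cost at most [t * (e / 2)]; the [+ 1] covers [r = 0]. *)
pose e' := (e / 2 / (r + 1))%R.
have e'0 : (0 < e')%R by rewrite !divr_gt0// ltr_wpDl.
have e'r : (e' * r <= e / 2)%R.
  rewrite /e' mulrAC ler_pdivrMr; last by rewrite ltr_wpDl.
  by apply: ler_wpM2l; [rewrite divr_ge0// ltW | rewrite lerDl].
have /eqoP /(_ _ e'0) := gd u Qu.
move=> /nbhs_ballP[rho /= rho0 near_u].
(* The three bounds on [t] keep [y] on the segment, keep it in the ball of radius [rho], and make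
   the second-order loss [t * s] at most [e / 2]. *)
pose t : R := (Num.min 1 (Num.min (rho / 2 / (r + 1)) (e / 2 / (`|s| + 1))))%R.
have t0 : (0 < t)%R.
  by rewrite !lt_min ltr01/= !divr_gt0//= ltr_wpDl.
have t1 : (t <= 1)%R by rewrite ge_min lexx.
have trho : (t * r < rho)%R.
  have tle : (t <= rho / 2 / (r + 1))%R by rewrite /t !ge_min lexx /= orbT.
  have : (t * (r + 1) <= rho / 2)%R.
    by rewrite -ler_pdivlMr// ltr_wpDl.
  by lra.
have ts : (t * `|s| <= e / 2)%R.
  have tle : (t <= e / 2 / (`|s| + 1))%R by rewrite /t !ge_min lexx !orbT.
  have : (t * (`|s| + 1) <= e / 2)%R.
    by rewrite -ler_pdivlMr// ltr_wpDl.
  by lra.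
have t01 : (0 <= t <= 1)%R by rewrite ltW.
pose y := (t *: v + (1 - t) *: u)%R.
have Qy : Q y by exact: convex_set_conv.
have yuE : (y - u = t *: (v - u))%R.
  by rewrite /y scalerBl scale1r scalerBr addrA addrAC addrK.
have ball_y : ball u rho y.
  by rewrite -ball_normE /= distrC yuE normrZ gtr0_norm.
have := near_u y ball_y Qy.
rewrite yuE linearZ /= normrZ (gtr0_norm t0) -/r => grad.
have {}grad : (`|fine (d y) - fine (d u) - t * dd u (v - u)| <= e' * (t * r))%R.
  exact: grad.
have := sd v u t Qv Qu t01; rewrite -/y.
rewrite -(fineK (fd y (mem_set Qy))) -(fineK (fd u (mem_set Qu))).
rewrite -(fineK (fd v (mem_set Qv))) -!EFinM -!EFinD lee_fin -/r => sc.
(* At scale [t], the gradient error and the loss [t * (t * s)] take [t * (e / 2)] each, which uses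
   up [t * e]. *)
rewrite -(ler_pM2l t0).
move: grad; rewrite ler_norml => /andP[grad _].
have te' : (t * (e' * r) <= t * (e / 2))%R by rewrite ler_pM2l.
have tts : (t * (t * s) <= t * (e / 2))%R.
  rewrite ler_pM2l//; apply: le_trans ts.
  by rewrite ler_pM2l// ler_norm.
have {sc} : (fine (d y) <= t * fine (d v) + (1 - t) * fine (d u)
                           - t * (1 - t) * s)%R.
  by apply: le_trans sc _; rewrite /s; lra.
move: (dd u _ : R) grad te' tts => /= D.
lra.
Qed.

Lemma fin_num_dom (R : realType) (E : normedVectType R) (Q : set E)
    (g : E -> \bar R) :
  (forall u, -oo < g u) -> Q `<=` dom g -> {in Q, forall u, g u \is a fin_num}.
Proof. by move=> gNy gQ u /[!inE] /gQ gy; rewrite fin_numElt gNy. Qed.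

(** * The iterates of the method: finiteness, membership in [Q], uniform recursions *)

Section MethodS.
Context {R : realType} {E : normedVectType R}.
Variables (Q : set E) (d : E -> \bar R) (dd : E -> {linear E -> R^o}).
Variables (sigma_d : R) (x0 : E).
Variables (f : E -> \bar R) (m : E -> E -> \bar R) (sigma_f bsigma_f : R).
Variables (L : E -> R) (delta : E -> E -> R).
Variables (lambda beta : nat -> R) (v : version).
Variables (phi psi : nat -> E -> \bar R) (x z w xhat : nat -> E).
Hypothesis Q_convex : convex_set (Q : set (convex_lmodType E)).
Hypothesis d_prox : prox_function Q d dd sigma_d x0.
Hypothesis f_sp : structured_problem Q d dd f m sigma_f bsigma_f L delta.
Hypothesis params : method_parameters lambda beta.
Hypothesis gen :
  method_S Q d dd lambda beta v m sigma_f x0 phi psi x z w xhat.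

Local Notation S := (Ssum lambda).
Local Notation xi := (xi d dd).
Local Notation l_d := (l_d d dd).
Local Notation F u := (fine (f u)).
Local Notation M y u := (fine (m y u)).

Let prop2 := ms_property2 gen.

Let f_fin : {in Q, forall u, f u \is a fin_num}.
Proof. by apply: fin_num_dom (sp_f_dom f_sp) => u; case: (sp_f f_sp). Qed.

Let m_fin y : Q y -> {in Q, forall u, m y u \is a fin_num}.
Proof.
by move=> Qy; apply: fin_num_dom (sp_m_dom f_sp Qy) => u; case: (sp_m f_sp Qy).
Qed.

Let d_fin : {in Q, forall u, d u \is a fin_num}.
Proof. by apply: fin_num_dom (prox_dom d_prox) => u; case: d_prox. Qed.

Let fE u : Q u -> f u = (F u)%:E.
Proof. by move=> Qu; rewrite fineK// f_fin// inE. Qed.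

Let mE y u : Q y -> Q u -> m y u = (M y u)%:E.
Proof. by move=> Qy Qu; rewrite fineK// m_fin// inE. Qed.

Let dE u : Q u -> d u = (fine (d u))%:E.
Proof. by move=> Qu; rewrite fineK// d_fin// inE. Qed.

Let f_convex : convex_on Q f.
Proof. by move=> u u' t _ _; case: (sp_f f_sp) => _ + _; apply. Qed.

Let m_convex y : Q y -> convex_on Q (m y).
Proof. by move=> Qy u u' t _ _; case: (sp_m f_sp Qy) => _ + _; apply. Qed.

Let m_le y u : Q y -> Q u -> (M y u <= F u)%R.
Proof.
by move=> Qy Qu; have := sp_m_le f_sp Qy Qu; rewrite mE// fE// lee_fin.
Qed.

Let Qz n : Q (z n). Proof. by case: (p2_z prop2 n). Qed.

Let Qw n : Q (w n). Proof. by case: (p2_w prop2 n). Qed.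

Let Qx0 : Q x0. Proof. by case: (prox_argmin d_prox). Qed.

Let SS n : S n.+1 = (S n + lambda n)%R.
Proof. by rewrite /Ssum big_ord_recr. Qed.

Let S0 : S 0%N = 0%R. Proof. by rewrite /Ssum big_ord0. Qed.

Let S_ge0 n : (0 <= S n)%R.
Proof. by apply: sumr_ge0 => i _; rewrite ltW// (lambda_gt0 params). Qed.

Let S_gt0 n : (0 < S n.+1)%R.
Proof. by rewrite SS ltr_wpDl// (lambda_gt0 params). Qed.

(* Any point of Q would do at n = 0, where its weight S 0 is null. *)
Let xhat_prev n := if n is k.+1 then xhat k else x0.

(** Since [S 0 = 0], the initialization [xhat 0 = w 1] is an instance of the recursion, which spares
    a separate base case. *)
Let xhatE n :
  xhat n = ((S n + lambda n)^-1
              *: (S n *: xhat_prev n + lambda n *: w n.+1))%R.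
Proof.
case: n => [|n]; last by rewrite (ms_xhatS gen) -SS.
rewrite (ms_xhat0 gen) S0 scale0r !add0r scalerA mulVf ?scale1r//.
by rewrite gt_eqF// (lambda_gt0 params).
Qed.

Let x_classicalE n : v = Classical -> x n = z n.
Proof.
move=> vC; case: n => [|n]; last by rewrite (ms_xS gen) vC.
by rewrite (ms_x0 gen); case: (p2_B1 prop2).
Qed.

Let x_modifiedE n : v = Modified ->
  x n = ((S n + lambda n)^-1 *: (S n *: xhat_prev n + lambda n *: z n))%R.
Proof.
move=> vM; case: n => [|n]; last by rewrite (ms_xS gen) vM -SS.
rewrite (ms_x0 gen) S0 scale0r !add0r scalerA mulVf ?scale1r//.
  by case: (p2_B1 prop2).
by rewrite gt_eqF// (lambda_gt0 params).
Qed.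

Let Qxhat_prev n : Q (xhat_prev n).
Proof.
elim: n => [//|n IHn]; rewrite [xhat_prev _]/= xhatE.
exact: weighted_mean_in (lambda_gt0 params n) IHn (Qw _).
Qed.

Let Qxhat n : Q (xhat n). Proof. exact: (Qxhat_prev n.+1). Qed.

Let Qx n : Q (x n).
Proof.
have [vC|vM] : v = Classical \/ v = Modified by case: v; [left|right].
  by rewrite x_classicalE.
rewrite x_modifiedE//.
exact: weighted_mean_in (lambda_gt0 params n) (Qxhat_prev n) (Qz n).
Qed.

Let xi_ge y u : Q y -> Q u -> (sigma_d / 2 * `|u - y| ^+ 2 <= xi y u)%R.
Proof.
move=> Qy Qu.
exact: (xi_lower_bound Q_convex d_fin (prox_gradient d_prox)
          (prox_strongly_convex d_prox)).
Qed.

(** * Inequalities for a single iteration *)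

Lemma model_upper_bound y u : Q y -> Q u ->
  (F u <= M y u + (L y - sigma_d * bsigma_f) / 2 * `|u - y| ^+ 2
          + delta y u)%R.
Proof.
move=> Qy Qu; have := sp_upper f_sp Qy Qu.
rewrite mE// fE// -!EFinD lee_fin distrC => /le_trans; apply.
have /andP[bs0 _] := sp_bsigma f_sp.
(* As [bsigma_f >= 0], the Bregman term can be traded for a multiple of the squared distance. *)
have := ler_wpM2l bs0 (xi_ge Qy Qu).
lra.
Qed.

(** The real lower bound [a] stands for the extended real [psi n (w n)], so that an induction
    hypothesis can be plugged in and the arithmetic stays in [R]. *)
Lemma psi_min_step n (a : R) : a%:E <= psi n (w n) ->
  (a + lambda n * M (x n) (w n.+1)
     + (beta n + S n * sigma_f) * (sigma_d / 2 * `|w n.+1 - z n| ^+ 2))%:E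
    <= psi n.+1 (w n.+1).
Proof.
move=> a_le; apply: le_trans (p2_B2 prop2 n (Qw n.+1)).
have phi_ge : a%:E <= phi n (z n).
  apply: (le_trans a_le); apply: le_trans (p2_B0 prop2 n (Qz n)).
  by case: (p2_w prop2 n) => _; apply.
rewrite (mE (Qx n) (Qw _)) (dE (Qw _)) -!EFinM -EFinN.
have [b0 bmono] := (beta_ge0 params n, beta_nondecreasing params).
have d0 : (0 <= fine (d (w n.+1)))%R.
  by rewrite -lee_fin -dE ?(prox_ge0 d_prox).
(* Hence [beta n.+1 * d - beta n * l_d] at [w n.+1] is at least [beta n * xi]. *)
have bd : (beta n * fine (d (w n.+1)) <= beta n.+1 * fine (d (w n.+1)))%R.
  by rewrite ler_wpM2r// bmono.
have sf0 : (0 <= sigma_f)%R.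
  by have /andP[bs0 /(le_trans bs0)] := sp_bsigma f_sp.
have B0 : (0 <= beta n + S n * sigma_f)%R by rewrite addr_ge0// mulr_ge0.
have xiB := ler_wpM2l B0 (xi_ge (Qz n) (Qw n.+1)).
rewrite -!addeA -!EFinD.
apply: le_trans (leeD phi_ge (lexx _)).
rewrite -EFinD lee_fin.
by rewrite [xi _ _]/Defs.xi in xiB *; lra.
Qed.

(** The infimum in B3 is at most its value at [u], where each model lies below [f]. *)
Lemma psi_min_upper_bound n u (a : R) : Q u -> a%:E <= psi n (w n) ->
  (a <= S n * F u + beta n * l_d (z n) u - S n * sigma_f * xi (z n) u)%R.
Proof.
move=> Qu /le_trans/(_ (p2_B3 prop2 n)) a_le.
have {}a_le : a%:E <= \sum_(i < n) (lambda i)%:E * m (x i) u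
    + (beta n * l_d (z n) u)%:E - (S n * sigma_f * xi (z n) u)%:E.
  by apply: (le_trans a_le); apply: ereal_inf_lbound; exists u.
have : a%:E <= (S n * F u)%:E
    + (beta n * l_d (z n) u)%:E - (S n * sigma_f * xi (z n) u)%:E.
  apply: (le_trans a_le); apply: leeB => //; apply: leeD => //.
  rewrite /Ssum mulr_suml -sumEFin; apply: lee_sum => i _.
  rewrite mE// -EFinM lee_fin ler_wpM2l ?m_le//.
  exact/ltW/(lambda_gt0 params).
by rewrite -!EFinD lee_fin.
Qed.

(** * Inductive estimates for the two variants *)

Lemma classical_estimate n : v = Classical ->
  (\sum_(i < n) lambda i * F (w i.+1)
   - (2^-1 * (\sum_(i < n) lambda i *
        (L (x i) - sigma_d *
           (bsigma_f + (beta i + S i * sigma_f) / lambda i)) *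
        `|w i.+1 - x i| ^+ 2)
      + \sum_(i < n) lambda i * delta (x i) (w i.+1)))%:E <= psi n (w n).
Proof.
move=> vC; elim: n => [|n IHn].
  by rewrite !big_ord0 mulr0 addr0 subr0; case: (p2_B1 prop2) => ->.
apply: le_trans (psi_min_step IHn); rewrite lee_fin !big_ord_recr /=.
have l0 := lambda_gt0 params n.
have := ler_wpM2l (ltW l0) (model_upper_bound (Qx n) (Qw n.+1)).
(* The distance to [z n] in [psi_min_step] becomes the distance to [x n] that occurs in [Cterm]. *)
rewrite -(x_classicalE n vC).
have -> : (lambda n * (L (x n) - sigma_d *
             (bsigma_f + (beta n + S n * sigma_f) / lambda n))
           = lambda n * (L (x n) - sigma_d * bsigma_f)
             - sigma_d * (beta n + S n * sigma_f))%R.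
  by field; rewrite gt_eqF.
lra.
Qed.

Lemma modified_estimate n : v = Modified ->
  (S n * F (xhat_prev n)
   - (2^-1 * (\sum_(i < n) S i.+1 *
        (L (x i) - sigma_d *
           (bsigma_f + S i.+1 * (beta i + S i * sigma_f) / lambda i ^+ 2)) *
        `|xhat i - x i| ^+ 2)
      + \sum_(i < n) S i.+1 * delta (x i) (xhat i)))%:E <= psi n (w n).
Proof.
move=> vM; elim: n => [|n IHn].
  by rewrite !big_ord0 S0 mul0r mulr0 addr0 subr0; case: (p2_B1 prop2) => ->.
apply: le_trans (psi_min_step IHn); rewrite lee_fin !big_ord_recr /=.
have l0 := lambda_gt0 params n.
(* [xhat n] and [x n] are means with the same weights and the same first point [xhat_prev n], which
   cancels in their difference. *)
have wz : (`|w n.+1 - z n| ^+ 2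
           = (S n.+1 ^+ 2 / lambda n ^+ 2) * `|xhat n - x n| ^+ 2)%R.
  have -> : (xhat n - x n = (lambda n / S n.+1) *: (w n.+1 - z n))%R.
    rewrite xhatE x_modifiedE// -SS -scalerBr opprD addrACA subrr add0r.
    by rewrite -scalerBr scalerA mulrC.
  rewrite normrZ gtr0_norm ?divr_gt0// exprMn; field.
  by rewrite !gt_eqF.
(* The term [S n * F (xhat_prev n)] from the induction hypothesis dominates the model there;
   convexity merges it with [lambda n * M (x n) (w n.+1)] into a bound at [xhat n]. *)
have := ler_wpM2l (S_ge0 n) (m_le (Qx n) (Qxhat_prev n)).
have := convex_on_weighted_mean Q_convex (m_convex (Qx n)) (m_fin (Qx n))
          (S_ge0 n) l0 (Qxhat_prev n) (Qw n.+1).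
rewrite -xhatE -SS wz.
have := ler_wpM2l (ltW (S_gt0 n)) (model_upper_bound (Qx n) (Qxhat n)).
have -> : (S n.+1 * (L (x n) - sigma_d *
             (bsigma_f + S n.+1 * (beta n + S n * sigma_f) / lambda n ^+ 2))
           = S n.+1 * (L (x n) - sigma_d * bsigma_f) - sigma_d *
             ((beta n + S n * sigma_f) * (S n.+1 ^+ 2 / lambda n ^+ 2)))%R.
  by field; rewrite gt_eqF.
set q := (S n.+1 ^+ 2 / _)%R.
lra.
Qed.

(** Jensen's inequality, one mean at a time; it transfers the classical estimate from the weighted
    sum to [xhat]. *)
Lemma xhat_le_weighted_sum n :
  (S n * F (xhat_prev n) <= \sum_(i < n) lambda i * F (w i.+1))%R.
Proof.
elim: n => [|n IHn]; first by rewrite S0 mul0r big_ord0.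
rewrite big_ord_recr/= {1}SS xhatE.
apply: (@le_trans _ _ (S n * F (xhat_prev n) + lambda n * F (w n.+1))%R).
  exact: (convex_on_weighted_mean Q_convex f_convex f_fin (S_ge0 n)
            (lambda_gt0 params n) (Qxhat_prev n) (Qw n.+1)).
by rewrite lerD2r.
Qed.

(** * Convergence rates *)

Let C_ := Cterm lambda beta v sigma_d sigma_f bsigma_f L delta x w xhat.

(** The final division by [S k.+1], shared by the three rates: [y] is the value of [f] at [xhat],
    the weighted average or the minimum, and [a / S k.+1] bounds it. *)
Lemma gap_bound k u (y : \bar R) (a : R) : Q u ->
  y <= (a / S k.+1)%:E -> (a - C_ k)%:E <= psi k.+1 (w k.+1) ->
  y - f u + (sigma_f * xi (z k.+1) u)%:E
    <= ((beta k.+1 * l_d (z k.+1) u + C_ k) / S k.+1)%:E.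
Proof.
move=> Qu y_le /(psi_min_upper_bound Qu) a_le; have Sk := S_gt0 k.
rewrite fE//; apply: (le_trans (leeD (leeB y_le (lexx _)) (lexx _))).
rewrite -!EFinD lee_fin ler_pdivlMr// !mulrDl divfK ?gt_eqF//.
lra.
Qed.

Lemma xhat_bound k : f (xhat k) <= (S k.+1 * F (xhat k) / S k.+1)%:E.
Proof. by rewrite mulrAC divff ?gt_eqF// mul1r -fE. Qed.

Lemma xhat_estimate k : (S k.+1 * F (xhat k) - C_ k)%:E <= psi k.+1 (w k.+1).
Proof.
have [vC|vM] : v = Classical \/ v = Modified by case: v; [left|right].
  rewrite /C_ vC; apply: le_trans (classical_estimate k.+1 vC).
  by rewrite lee_fin lerD2r (xhat_le_weighted_sum k.+1).
by rewrite /C_ vM; exact: (modified_estimate k.+1 vM).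
Qed.

Lemma weighted_averageE k :
  ((S k.+1)^-1)%:E * (\sum_(i < k.+1) (lambda i)%:E * f (w i.+1))
    = ((\sum_(i < k.+1) lambda i * F (w i.+1)) / S k.+1)%:E.
Proof.
under eq_bigr => i _ do rewrite fE// -EFinM.
by rewrite sumEFin -EFinM mulrC.
Qed.

Lemma min_le_weighted_average k :
  \big[Order.min/+oo]_(i < k.+1) f (w i.+1)
    <= ((\sum_(i < k.+1) lambda i * F (w i.+1)) / S k.+1)%:E.
Proof.
set a := (_ / _)%R.
have [[i Fi]|F_gt] := pselect (exists i : 'I_k.+1, (F (w i.+1) <= a)%R).
  by apply: (le_trans (bigmin_le _ i _)); rewrite fE// lee_fin.
(* If every value exceeded the average [a], summing with the positive weights would give this strict
   inequality; [ord0] shows that the sum is nonempty. *)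
suff : (a * S k.+1 < a * S k.+1)%R by rewrite ltxx.
rewrite [ltRHS]divfK ?gt_eqF// /Ssum mulr_sumr; apply: ltr_sum.
  by apply/hasP; exists ord0; rewrite ?mem_index_enum.
move=> i _; rewrite mulrC ltr_pM2l ?(lambda_gt0 params)// ltNge.
by apply/negP => Fi; apply: F_gt; exists i.
Qed.

Lemma classical_sum_estimate k : v = Classical ->
  (\sum_(i < k.+1) lambda i * F (w i.+1) - C_ k)%:E <= psi k.+1 (w k.+1).
Proof. by move=> vC; rewrite /C_ vC; exact: classical_estimate. Qed.

End MethodS.

Theorem theorem4p2 (R : realType) (E : normedVectType R)
    (Q : set E) (Q_closed : closed Q)
    (Q_convex : convex_set (Q : set (convex_lmodType E)))
    (d : E -> \bar R) (dd : E -> {linear E -> R^o}) (sigma_d : R) (x0 : E)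
    (d_prox : prox_function Q d dd sigma_d x0)
    (f : E -> \bar R) (m : E -> E -> \bar R) (sigma_f bsigma_f : R)
    (L : E -> R) (delta : E -> E -> R)
    (f_sp : structured_problem Q d dd f m sigma_f bsigma_f L delta)
    (xstar : E) (xstar_opt : is_argmin Q f xstar)
    (lambda beta : nat -> R) (params : method_parameters lambda beta)
    (v : version)
    (phi psi : nat -> E -> \bar R) (x z w xhat : nat -> E)
    (gen : method_S Q d dd lambda beta v m sigma_f x0 phi psi x z w xhat) :
  let C_ := Cterm lambda beta v sigma_d sigma_f bsigma_f L delta x w xhat in
  let xi_ k := (sigma_f * xi d dd (z k.+1) xstar)%:E in
  let bound k :=
    ((beta k.+1 * l_d d dd (z k.+1) xstar + C_ k) / Ssum lambda k.+1)%:E in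
  (forall k : nat, f (xhat k) - f xstar + xi_ k <= bound k)
  /\
  (v = Classical ->
    (forall k : nat,
      ((Ssum lambda k.+1)^-1)%:E * (\sum_(i < k.+1) (lambda i)%:E * f (w i.+1))
        - f xstar + xi_ k <= bound k)
    /\
    (forall k : nat,
      \big[Order.min/+oo]_(i < k.+1) f (w i.+1) - f xstar + xi_ k
        <= bound k)).
Proof.
move=> C_ xi_ bound.
have [Qs _] := xstar_opt.
split=> [k|vC].
  apply: (gap_bound Q_convex d_prox f_sp params gen Qs).
    exact: (xhat_bound Q_convex d_prox f_sp params gen k).
  exact: (xhat_estimate Q_convex d_prox f_sp params gen k).
have estimate k := classical_sum_estimate Q_convex d_prox f_sp params gen k vC.
split=> k.
  apply: (gap_bound Q_convex d_prox f_sp params gen Qs _ (estimate k)).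
  by rewrite (weighted_averageE f_sp gen).
apply: (gap_bound Q_convex d_prox f_sp params gen Qs _ (estimate k)).
exact: (min_le_weighted_average f_sp params gen k).
Qed.
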